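(* For every $n\ge 2$, the tropicalization of the Pollaczek-Geiringer variety $\mathrm{CM}_n^2$ is the Minkowski sum of two copies of the set of ultrametrics on $[n]$: $$\mathrm{trop}(\mathrm{CM}_n^2)=U_n+U_n=\{\delta+\delta' : \delta,\delta'\in U_n\}\subseteq \mathbb{R}^{\binom{[n]}{2}}.$$
   Context: Coordinates of $\mathbb{C}^{\binom{[n]}{2}}$ and $\mathbb{R}^{\binom{[n]}{2}}$ are indexed by unordered pairs $uv$ with $u<v$ in $[n]=\{1,\dots,n\}$. The Cayley-Menger variety $\mathrm{CM}_n^d\subseteq\mathbb{C}^{\binom{[n]}{2}}$ is the Zariski closure of the set of vectors $(\|p_u-p_v\|^2)_{u<v}$ where $p_1,\dots,p_n$ range over $\mathbb{R}^d$; for $d=2$ it is called the Pollaczek-Geiringer variety. Tropicalization uses the max convention: let $K=\mathbb{C}\{\!\{t\}\!\}$ be the field of complex Puiseux series with valuation $\mathrm{val}(a)=-(\text{smallest exponent of } t \text{ occurring in } a)$ and $\mathrm{val}(0)=-\infty$. For a variety $X\subseteq\mathbb{C}^S$ with ideal $I$, let $X'\subseteq K^S$ be the vanishing set of $I\cdot K[x_i:i\in S]$; then $\mathrm{trop}(X)$ is the Euclidean closure of $\{(\mathrm{val}(x_i))_{i\in S}: x\in X'\}\cap\mathbb{R}^S$. A vector $\delta\in\mathbb{R}^{\binom{[n]}{2}}$ is an ultrametric if $\delta_{uv}\le\max\{\delta_{uw},\delta_{vw}\}$ for all triples of distinct $u,v,w\in[n]$ (no nonnegativity is required); $U_n$ denotes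 the set of all ultrametrics in $\mathbb{R}^{\binom{[n]}{2}}$. *)

(* Defs.v *)
From HB Require Import structures.
From mathcomp Require Import all_boot all_order all_algebra.
From mathcomp Require Import boolp classical_sets fsbigop reals.
From mathcomp Require Import complex.

Set Implicit Arguments.
Unset Strict Implicit.
Unset Printing Implicit Defensive.

Import Order.TTheory GRing.Theory Num.Theory.
Local Open Scope ring_scope.
Local Open Scope classical_set_scope.

Definition pairs (n : nat) := {p : 'I_n * 'I_n | (p.1 < p.2)%N}.

Definition pval (T : Type) (n : nat) (d0 : T) (d : pairs n -> T) (u v : 'I_n) : T :=
  match @insub _ (fun p : 'I_n * 'I_n => (p.1 < p.2)%N) (pairs n) (u, v) with
  | Some s => d s
  | None =>
    match @insub _ (fun p : 'I_n * 'I_n => (p.1 < p.2)%N) (pairs n) (v, u) with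
    | Some s => d s
    | None => d0
    end
  end.

(** * Ultrametrics (no nonnegativity required). *)
Definition ultrametric (R : realType) (n : nat) (d : pairs n -> R) : Prop :=
  forall u v w : 'I_n, u != v -> v != w -> u != w ->
    pval 0 d u v <= Num.max (pval 0 d u w) (pval 0 d v w).

Definition U_ (R : realType) (n : nat) : set (pairs n -> R) :=
  [set d | ultrametric d].

Definition minkowski (R : realType) (n : nat) (A B : set (pairs n -> R))
  : set (pairs n -> R) :=
  [set x | exists d, exists d', A d /\ B d' /\ x = (fun s => d s + d' s)].

Notation Cx R := (complex R).

(** * Puiseux series over C, in raw form: coefficient functions rat -> C.
    a represents  sum_q a(q) t^q.  It is a Puiseux series iff its support lies in
    (1/N) Z and is bounded below. *)
Definition series (R : realType) := rat -> Cx R.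

Definition puiseux (R : realType) (a : series R) : Prop :=
  exists N : nat, (0 < N)%N /\ exists m : int,
    forall q : rat, a q != 0 ->
      exists k : int, q = k%:~R / N%:R /\ m <= k.

Definition szero (R : realType) : series R := fun _ => 0.
Definition sconst (R : realType) (c : Cx R) : series R :=
  fun q => if q == 0 then c else 0.
Definition sadd (R : realType) (a b : series R) : series R := fun q => a q + b q.
(** Cauchy product: the sum is finite for Puiseux series. *)
Definition smul (R : realType) (a b : series R) : series R :=
  fun q => \sum_(p \in [set: rat]) (a p * b (q - p)).
Definition spow (R : realType) (a : series R) (k : nat) : series R :=
  iter k (smul a) (sconst 1).

Definition cpoly (n : nat) (R : realType) := seq (Cx R * {ffun pairs n -> nat}).

Definition evalC (R : realType) (n : nat) (f : cpoly n R) (y : pairs n -> Cx R)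
  : Cx R :=
  \sum_(t <- f) (t.1 * \prod_(s : pairs n) y s ^+ (t.2 s)).

Definition evalK (R : realType) (n : nat) (f : cpoly n R) (x : pairs n -> series R)
  : series R :=
  foldr (fun (t : Cx R * {ffun pairs n -> nat}) acc =>
           sadd (smul (sconst t.1)
                      (\big[@smul R/sconst 1]_(s : pairs n) spow (x s) (t.2 s))) acc)
        (szero R) f.

Definition sqdist2 (R : realType) (n : nat) (p : 'I_n -> R * R) : pairs n -> Cx R :=
  fun s => let u := (val s).1 in let v := (val s).2 in
    ((((p u).1 - (p v).1) ^+ 2 + ((p u).2 - (p v).2) ^+ 2) %:C)%C.

(** f belongs to the ideal I of CM_n^2 = Zariski closure of the image of sqdist2
    iff f vanishes on that image. *)
Definition in_ideal_PG (R : realType) (n : nat) (f : cpoly n R) : Prop :=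
  forall p : 'I_n -> R * R, evalC f (sqdist2 p) = 0.

(** X' : the vanishing set in K^S of I . K[x]. *)
Definition PG_K (R : realType) (n : nat) : set (pairs n -> series R) :=
  [set x | (forall s, puiseux (x s)) /\
           forall f : cpoly n R, in_ideal_PG f -> evalK f x = szero R].

Definition valvec (R : realType) (n : nat) (x : pairs n -> series R)
  (w : pairs n -> R) : Prop :=
  forall s, exists q : rat,
    x s q != 0 /\ (forall q', q' < q -> x s q' = 0) /\ w s = - ratr q.

Definition eclosure (R : realType) (n : nat) (A : set (pairs n -> R))
  : set (pairs n -> R) :=
  [set w | forall e : R, 0 < e ->
     exists v, A v /\ forall s, `|w s - v s| < e].

Definition trop_PG (R : realType) (n : nat) : set (pairs n -> R) :=
  eclosure [set w | exists x, PG_K x /\ valvec x w].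

(* Main.v *)
(* Over C the squared distance factors as (a_u - a_v)(b_u - b_v), with
   a = x + iy and b = x - iy, so CM_n^2 is the Hadamard square of the linear space
   {(a_u - a_v)}, whose tropicalization is U_n.  Working with Laurent series in
   s = t^(1/N):
   - given x in CM_n^2(K), the 3x3 minors of the Gram matrix
     x_uo + x_vo - x_uv vanish, so this matrix has rank at most two and its
     quadratic form is, up to a scalar, a product of two linear forms; hence
     z x_uv = (a_u - a_v)(b_u - b_v), and the valuations of a_u - a_v and of
     b_u - b_v are ultrametrics;
   - conversely, rounding an ultrametric down to multiples of 1/N preserves the
     ultrametric inequality, and an integral ultrametric is the valuation of a_u - a_v
     for suitable polynomials a_u in s;
   - U_n + U_n is closed, being a finite union of projections of polyhedra. *)
Require Import Defs.
From HB Require Import structures.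
From mathcomp Require Import all_boot all_order all_algebra.
From mathcomp Require Import boolp classical_sets fsbigop reals.
From mathcomp Require Import complex zify ring lra.

Set Implicit Arguments.
Unset Strict Implicit.
Unset Printing Implicit Defensive.

Import Order.TTheory GRing.Theory Num.Theory.
Local Open Scope ring_scope.

(** * Formal power series *)

Record fps (F : fieldType) := FPS { coefs : nat -> F }.

Section PowerSeries.
Variable F : fieldType.
Implicit Types A B : fps F.

HB.instance Definition _ := gen_eqMixin (fps F).
HB.instance Definition _ := gen_choiceMixin (fps F).

Lemma fpsP A B : (forall k, coefs A k = coefs B k) -> A = B.
Proof. by case: A B => [a] [b] /= /funext ->. Qed.

Definition fps_const (c : F) := FPS (fun k => if k == 0%N then c else 0).
Definition fps_opp A := FPS (fun k => - coefs A k).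
Definition fps_add A B := FPS (fun k => coefs A k + coefs B k).
Definition fps_mul A B :=
  FPS (fun k => \sum_(i < k.+1) coefs A i * coefs B (k - i)%N).

Lemma fps_addA : associative fps_add.
Proof. by move=> A B C; apply: fpsP => k /=; rewrite addrA. Qed.
Lemma fps_addC : commutative fps_add.
Proof. by move=> A B; apply: fpsP => k /=; rewrite addrC. Qed.
Lemma fps_add0 : left_id (fps_const 0) fps_add.
Proof. by move=> A; apply: fpsP => k /=; rewrite if_same add0r. Qed.
Lemma fps_addN : left_inverse (fps_const 0) fps_opp fps_add.
Proof. by move=> A; apply: fpsP => k /=; rewrite if_same addNr. Qed.

HB.instance Definition _ :=
  GRing.isZmodule.Build (fps F) fps_addA fps_addC fps_add0 fps_addN.

(* The ring axioms are inherited from polynomials, because the k-th coefficient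
   of a product depends only on the truncations at degree k. *)
Definition fps_trunc n A : {poly F} := \poly_(i < n.+1) coefs A i.

Lemma coef_fps_trunc n A k : (k <= n)%N -> (fps_trunc n A)`_k = coefs A k.
Proof. by move=> kn; rewrite coef_poly ltnS kn. Qed.

Lemma coef_mul_trunc n A B k :
  (k <= n)%N -> coefs (fps_mul A B) k = (fps_trunc n A * fps_trunc n B)`_k.
Proof.
move=> kn; rewrite coefM; apply: eq_bigr => i _.
by rewrite !coef_fps_trunc // (leq_trans _ kn) ?leq_subr // -ltnS.
Qed.

Lemma eq_coefM (p q p' q' : {poly F}) k :
  (forall i, (i <= k)%N -> p`_i = p'`_i) ->
  (forall i, (i <= k)%N -> q`_i = q'`_i) -> (p * q)`_k = (p' * q')`_k.
Proof.
move=> pE qE; rewrite !coefM; apply: eq_bigr => i _.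
by rewrite pE ?qE ?leq_subr // -ltnS.
Qed.

Lemma fps_mulC : commutative fps_mul.
Proof.
by move=> A B; apply: fpsP => k; rewrite !(@coef_mul_trunc k) // mulrC.
Qed.

Lemma fps_mulA : associative fps_mul.
Proof.
move=> A B C; apply: fpsP => k; rewrite !(@coef_mul_trunc k) //.
transitivity (fps_trunc k A * (fps_trunc k B * fps_trunc k C))`_k.
  by apply: eq_coefM => // i ik; rewrite coef_fps_trunc ?(@coef_mul_trunc k).
rewrite mulrA; apply: eq_coefM => // i ik.
by rewrite coef_fps_trunc ?(@coef_mul_trunc k).
Qed.

Lemma fps_mul1 : left_id (fps_const 1) fps_mul.
Proof.
move=> A; apply: fpsP => k /=; rewrite big_ord_recl /= subn0 mul1r big1 ?addr0 //.
by move=> i _; rewrite mul0r.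
Qed.

Lemma fps_mulDl : left_distributive fps_mul fps_add.
Proof.
move=> A B C; apply: fpsP => k /=; rewrite -big_split /=.
by apply: eq_bigr => i _; rewrite mulrDl.
Qed.

Lemma fps_1neq0 : fps_const 1 != 0 :> fps F.
Proof.
apply/eqP => /(congr1 (fun A => coefs A 0)) /= /eqP; exact/negP/oner_neq0.
Qed.

HB.instance Definition _ := GRing.Zmodule_isComNzRing.Build (fps F)
  fps_mulA fps_mulC fps_mul1 fps_mulDl fps_1neq0.

Lemma coef_fps0 k : coefs (0 : fps F) k = 0.
Proof. exact: if_same. Qed.
Lemma coef_fpsD A B k : coefs (A + B) k = coefs A k + coefs B k.
Proof. by []. Qed.
Lemma coef_fpsN A k : coefs (- A) k = - coefs A k.
Proof. by []. Qed.
Lemma coef_fpsB A B k : coefs (A - B) k = coefs A k - coefs B k.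
Proof. by []. Qed.
Lemma coef_fpsM A B k :
  coefs (A * B) k = \sum_(i < k.+1) coefs A i * coefs B (k - i)%N.
Proof. by []. Qed.

Definition fps_poly (p : {poly F}) := FPS (fun k => p`_k).

Lemma fps_poly_is_zmod : zmod_morphism fps_poly.
Proof. by move=> p q; apply: fpsP => k; rewrite coef_fpsB /= coefB. Qed.
Lemma fps_poly_is_monoid : monoid_morphism fps_poly.
Proof.
split; first by apply: fpsP => k /=; rewrite coef1; case: k.
by move=> p q; apply: fpsP => k; rewrite coef_fpsM /= coefM.
Qed.
HB.instance Definition _ :=
  GRing.isZmodMorphism.Build {poly F} (fps F) fps_poly fps_poly_is_zmod.
HB.instance Definition _ :=
  GRing.isMonoidMorphism.Build {poly F} (fps F) fps_poly fps_poly_is_monoid.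

Lemma coef_fpsXnM A j k : coefs (fps_poly 'X^j * A) k =
  if (k < j)%N then 0 else coefs A (k - j)%N.
Proof.
rewrite [LHS](@coef_mul_trunc k) //.
rewrite (@eq_coefM _ _ 'X^j (fps_trunc k A) k) => [||//]; last first.
  by move=> i ik; rewrite coef_fps_trunc.
by rewrite coefXnM; case: ltnP => // _; rewrite coef_fps_trunc ?leq_subr.
Qed.

(** * Orders of vanishing of power series *)

Definition hasord A k := coefs A k <> 0 /\ forall j, (j < k)%N -> coefs A j = 0.

Lemma hasord_ex A : A <> 0 -> exists k, hasord A k.
Proof.
move=> A0; have /existsNP[k /eqP k0] : ~ forall k, coefs A k = 0.
  by move=> A0'; apply: A0; apply: fpsP => k; rewrite A0' coef_fps0.
have ex : exists k, coefs A k != 0 by exists k.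
exists (ex_minn ex); case: ex_minnP => m m0 mmin; split; first exact/eqP.
by move=> j jm; apply/eqP; apply: contraTT jm => /mmin; rewrite -leqNgt.
Qed.

Lemma hasord_neq0 A k : hasord A k -> A <> 0.
Proof. by move=> [Ak _] A0; apply: Ak; rewrite A0 coef_fps0. Qed.

Lemma hasord_inj A k l : hasord A k -> hasord A l -> k = l.
Proof.
move=> [Ak kmin] [Al lmin]; case: (ltngtP k l) => // [/lmin|/kmin] //.
Qed.

Lemma hasordN A k : hasord A k -> hasord (- A) k.
Proof.
move=> [Ak kmin]; split => [|j /kmin /= ->]; last exact: oppr0.
by move/eqP; rewrite coef_fpsN oppr_eq0 => /eqP.
Qed.

Lemma hasord_ge A k m :
  hasord A k -> (forall j, (j < m)%N -> coefs A j = 0) -> (m <= k)%N.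
Proof. by move=> [Ak _] A0; rewrite leqNgt; apply/negP => /A0. Qed.

(** Below degree [k + l] every product has a factor below its own order, and in degree [k + l] only
    the product of the two lowest coefficients survives. *)
Lemma hasordM A B k l : hasord A k -> hasord B l -> hasord (A * B) (k + l).
Proof.
move=> [Ak kmin] [Bl lmin]; split.
  rewrite coef_fpsM (bigD1 (Ordinal (leq_addr l k : (k < (k + l).+1)%N))) //=.
  rewrite addKn big1 ?addr0 => [/eqP|i ik]; first by rewrite mulf_eq0 => /orP[] /eqP.
  have {}ik : (i : nat) != k by apply: contraNneq ik => ik; apply/eqP/val_inj.
  case: (ltngtP i k) ik => // [ik|ki] _; first by rewrite kmin // mul0r.
  by rewrite lmin ?mulr0 // ltn_subLR ?ltn_add2r // -ltnS.
move=> j jkl; rewrite coef_fpsM big1 // => i _.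
have [ik|ki] := ltnP i k; first by rewrite kmin // mul0r.
rewrite lmin ?mulr0 // ltn_subLR; last by rewrite -ltnS.
by apply: leq_trans jkl _; rewrite leq_add2r.
Qed.

Lemma fps_mul_neq0 A B : A <> 0 -> B <> 0 -> A * B <> 0.
Proof.
by move=> /hasord_ex[k Ak] /hasord_ex[l Bl]; apply: hasord_neq0 (hasordM Ak Bl).
Qed.

Lemma hasordM_inv A B m : hasord (A * B) m ->
  exists k l, [/\ hasord A k, hasord B l & m = (k + l)%N].
Proof.
move=> ABm; have [A0|A0] := pselect (A = 0).
  by case: (hasord_neq0 ABm); rewrite A0 mul0r.
have [B0|B0] := pselect (B = 0); first by case: (hasord_neq0 ABm); rewrite B0 mulr0.
have [k Ak] := hasord_ex A0; have [l Bl] := hasord_ex B0.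
by exists k, l; split => //; apply: hasord_inj ABm (hasordM Ak Bl).
Qed.

(** Since A - B = (A - C) - (B - C), it vanishes in every degree where both differences do. The
    ultrametric inequality for valuations of differences comes from here. *)
Lemma hasord_sub A B C k l m : hasord (A - B) k -> hasord (A - C) l ->
  hasord (B - C) m -> (minn l m <= k)%N.
Proof.
move=> ABk [_ ACl] [_ BCm]; apply: hasord_ge ABk _ => j.
rewrite leq_min => /andP[/ACl + /BCm]; rewrite !coef_fpsB => AC BC.
have -> : coefs A j - coefs B j = coefs A j - coefs C j - (coefs B j - coefs C j).
  by ring.
by rewrite AC BC subr0.
Qed.

(** The series in [s^2]. They are closed under the ring operations and their non-zero members have
    even order, which is what extracting a square root requires. *)
Definition fps_even A := forall k, odd k -> coefs A k = 0.

Lemma fps_evenD A B : fps_even A -> fps_even B -> fps_even (A + B).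
Proof. by move=> A0 B0 k k1; rewrite coef_fpsD A0 // B0 // addr0. Qed.
Lemma fps_evenN A : fps_even A -> fps_even (- A).
Proof. by move=> A0 k k1; rewrite coef_fpsN A0 // oppr0. Qed.
Lemma fps_evenM A B : fps_even A -> fps_even B -> fps_even (A * B).
Proof.
move=> A0 B0 k k1; rewrite coef_fpsM big1 // => i _.
have [i1|i1] := boolP (odd i); first by rewrite A0 // mul0r.
by rewrite B0 ?mulr0 // oddB ?k1 ?(negbTE i1) // -ltnS.
Qed.

Lemma hasord_even A k : fps_even A -> hasord A k -> ~~ odd k.
Proof. by move=> A0 [Ak _]; apply/negP => /A0. Qed.

End PowerSeries.

(** * Square roots of power series of even order *)

Section SquareRoot.
Variable F : closedFieldType.
Hypothesis two_neq0 : 2 != 0 :> F.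

(* Coefficients of a square root of U, where c^2 = U_0 is non-zero. *)
Fixpoint sqrt_coefs (U : fps F) (c : F) n : seq F :=
  if n isn't n'.+1 then [::] else
  let s := sqrt_coefs U c n' in
  rcons s (if n' is n''.+1 then
    (coefs U n' - \sum_(i < n'') s`_i.+1 * s`_(n' - i.+1)%N) / (2 * c) else c).

Lemma size_sqrt_coefs U c n : size (sqrt_coefs U c n) = n.
Proof. by elim: n => //= n IH; rewrite size_rcons IH. Qed.

Lemma nth_sqrt_coefs U c n k : (k < n)%N ->
  (sqrt_coefs U c n)`_k = (sqrt_coefs U c k.+1)`_k.
Proof.
elim: n => // n IH; rewrite ltnS leq_eqVlt => /orP[/eqP->//|kn].
by rewrite [in LHS]/= nth_rcons size_sqrt_coefs kn IH.
Qed.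

(** Algebraic closure gives a root [c] of the constant term. In degree [k + 1] the square is then
    [2 c b_(k+1)] plus a sum over earlier coefficients, which determines [b_(k+1)]. *)
Lemma fps_sqrt_unit (U : fps F) : coefs U 0 <> 0 -> exists B, B * B = U.
Proof.
move=> U0.
have [c cU] : exists c : F, c * c = coefs U 0.
  have [c] := @solve_monicpoly F 2 (fun i => if i == 0%N then coefs U 0 else 0) isT.
  by rewrite !big_ord_recl big_ord0 /= mulr1 mul0r !addr0 expr2; exists c.
have c0 : c != 0 by apply: contra_notN U0 => /eqP c0; rewrite -cU c0 mul0r.
pose b k := (sqrt_coefs U c k.+1)`_k.
exists (FPS b); apply: fpsP => -[|k]; rewrite coef_fpsM /=.
  by rewrite big_ord_recl big_ord0 addr0.
rewrite big_ord_recl big_ord_recr /= subn0 subSS subnn.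
have bE : b k.+1 = (coefs U k.+1 - \sum_(i < k) b i.+1 * b (k.+1 - i.+1)%N) / (2 * c).
  rewrite {1}/b [sqrt_coefs _ _ _]/= nth_rcons size_rcons size_sqrt_coefs ltnn eqxx.
  congr ((_ - _) / _); apply: eq_bigr => i _.
  rewrite -/(sqrt_coefs U c k.+1) (@nth_sqrt_coefs U c k.+1 i.+1) ?ltnS //.
  by rewrite (@nth_sqrt_coefs U c k.+1 (k.+1 - i.+1)) // ltnS subSS leq_subr.
have -> : b 0 = c by [].
rewrite bE; field; last by rewrite c0 two_neq0.
Qed.

(** Splitting off [X^k] leaves a series with non-zero constant term, whose root is multiplied by
    [X^(k/2)]. *)
Lemma fps_sqrt (A : fps F) k : hasord A k -> ~~ odd k -> exists B, B * B = A.
Proof.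
move=> [Ak kmin] kodd; pose U := FPS (fun i => coefs A (i + k)%N).
have [B BU] := @fps_sqrt_unit U Ak.
exists (fps_poly 'X^(k./2) * B).
have kE : (k./2 + k./2)%N = k by rewrite addnn -[RHS]odd_double_half (negbTE kodd).
rewrite mulrACA BU -rmorphM -exprD kE; apply: fpsP => i; rewrite coef_fpsXnM.
by case: ltnP => [/kmin->//|ki] /=; rewrite subnK.
Qed.

End SquareRoot.

(** * Laurent series in a root of t *)

Section LaurentSeries.
Variable R : realType.
Implicit Types A B : fps (Cx R).

(* The power series A(s) as the Puiseux series t^(-M/N) A(t^(1/N)). *)
Definition laurent (N M : nat) A : series R := fun q =>
  let r := q * N%:R + M%:R in
  if r \is a Num.nat then coefs A (Num.truncn r) else 0.

(** The exponent of [t] that carries coefficient [k] in [laurent N M A]. *)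
Definition expo (N M k : nat) : rat := (k%:R - M%:R) / N%:R.

Lemma expo_inj N M : (0 < N)%N -> injective (expo N M).
Proof.
move=> N0 k l /(divIf _) kl; apply/eqP; rewrite -(eqr_nat rat) -(inj_eq (addIr (- M%:R))).
by apply/eqP/kl; rewrite pnatr_eq0 -lt0n.
Qed.

Lemma laurentE N M A k : (0 < N)%N -> laurent N M A (expo N M k) = coefs A k.
Proof.
move=> N0; rewrite /laurent /expo divfK ?subrK ?natr_nat ?natrK //.
by rewrite pnatr_eq0 -lt0n.
Qed.

Lemma laurent_eq0 N M A q : (0 < N)%N ->
  (forall k, q = expo N M k -> coefs A k = 0) -> laurent N M A q = 0.
Proof.
move=> N0 qk; rewrite /laurent; case: ifP => // /natrP[k kE].
rewrite kE natrK qk // /expo -kE addrK mulfK // pnatr_eq0 -lt0n //.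
Qed.

Lemma laurent_eq N M A (a : series R) : (0 < N)%N ->
  (forall k, a (expo N M k) = coefs A k) ->
  (forall q, (forall k, q <> expo N M k) -> a q = 0) -> a = laurent N M A.
Proof.
move=> N0 aE a0; apply/funext => q.
have [[k ->]|nq] := pselect (exists k, q = expo N M k).
  by rewrite aE laurentE.
rewrite a0 ?laurent_eq0 // => k qk; by case: nq; exists k.
Qed.

Lemma expoD N M M' k l : expo N M k + expo N M' l = expo N (M + M') (k + l).
Proof. by rewrite /expo !natrD -mulrDl; congr (_ / _); ring. Qed.

Lemma ratr_expo N M k : ratr (expo N M k) = (k%:R - M%:R) / N%:R :> R.
Proof. by rewrite fmorph_div rmorphB !rmorph_nat. Qed.

Lemma ltr_expo N M k l : (0 < N)%N -> (expo N M k < expo N M l) = (k < l)%N.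
Proof.
by move=> N0; rewrite /expo ltr_pM2r ?invr_gt0 ?ltr0n // ltrD2r ltr_nat.
Qed.

Lemma sadd_laurent N M A B :
  sadd (laurent N M A) (laurent N M B) = laurent N M (A + B).
Proof. by apply/funext => q; rewrite /sadd /laurent /=; case: ifP => _ //; rewrite addr0. Qed.

Lemma szero_laurent N M : szero R = laurent N M 0.
Proof. by apply/funext => q; rewrite /laurent /= !if_same. Qed.

Lemma laurent_inj N M A : (0 < N)%N -> laurent N M A = szero R -> A = 0.
Proof.
move=> N0 A0; apply: fpsP => k; rewrite coef_fps0.
by rewrite -(laurentE M A k N0) A0.
Qed.

Lemma sconst_laurent N c : (0 < N)%N ->
  sconst c = laurent N 0 (fps_poly c%:P).
Proof.
move=> N0; apply: laurent_eq => // [k|q nq]; rewrite /sconst.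
  rewrite /expo mulr0n subr0 /= coefC mulf_eq0 invr_eq0 !pnatr_eq0 [N == _]eqn0Ngt N0 orbF //.
case: eqP => // q0; by case: (nq 0%N); rewrite /expo q0 subrr mul0r.
Qed.

(** The factor [X^j] compensates for the larger pole bound, so series with different [M] can be
    brought to a common one. *)
Lemma laurent_shift N M j A : (0 < N)%N ->
  laurent N M A = laurent N (M + j) (fps_poly 'X^j * A).
Proof.
move=> N0; apply: laurent_eq => // [k|q nq]; last first.
  apply: laurent_eq0 => // k qk; case: (nq (k + j)%N).
  by rewrite qk /expo !natrD; congr (_ / _); ring.
rewrite coef_fpsXnM; case: ltnP => [kj|jk].
  apply: laurent_eq0 => // l kl; have : expo N M l = expo N (M + j) (l + j).
    by rewrite /expo !natrD; congr (_ / _); ring.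
  by rewrite -kl => /(expo_inj N0) kE; move: kj; rewrite kE ltnNge leq_addl.
rewrite -(laurentE M A _ N0); congr laurent.
by rewrite /expo natrB // natrD; congr (_ / _); ring.
Qed.

Lemma smul_laurent N M M' A B : (0 < N)%N ->
  smul (laurent N M A) (laurent N M' B) = laurent N (M + M') (A * B).
Proof.
move=> N0; apply: laurent_eq => // [k|q nq]; rewrite /smul; last first.
  apply: fsbig1 => p _.
  have [[i pi]|np] := pselect (exists i, p = expo N M i); last first.
    by rewrite laurent_eq0 ?mul0r // => i pi; case: np; exists i.
  rewrite [X in _ * X]laurent_eq0 ?mulr0 // => j qj; case: (nq (i + j)%N).
  by rewrite -expoD -pi -qj addrC subrK.
(* A term is non-zero only for [p = expo N M i] with [i <= k], so the finitely supported sum over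
   the rationals runs over this list. *)
rewrite (fsbigE [seq expo N M i | i <- iota 0 k.+1]) //.
- rewrite big_map -[iota _ _]/(index_iota 0 k.+1) big_mkcond.
  rewrite big_mkord coef_fpsM; apply: eq_bigr => i _.
  rewrite in_setT laurentE //; congr (_ * _).
  have -> : expo N (M + M') k = expo N M i + expo N M' (k - i).
    by rewrite expoD subnKC // -ltnS.
  by rewrite addrC addKr laurentE.
- by rewrite map_inj_uniq ?iota_uniq //; exact: expo_inj.
move=> p _ /mapP np.
have [[i pi]|np'] := pselect (exists i, p = expo N M i); last first.
  by rewrite laurent_eq0 ?mul0r // => i pi; case: np'; exists i.
rewrite [X in _ * X]laurent_eq0 ?mulr0 // => j qj; case: np; exists i => //.
rewrite mem_iota ltnS /=; have : expo N (M + M') k = expo N (M + M') (i + j).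
  by rewrite -expoD -pi -qj addrC subrK.
by move=> /(expo_inj N0) ->; rewrite leq_addr.
Qed.

Lemma spow_laurent N M A k : (0 < N)%N ->
  spow (laurent N M A) k = laurent N (M * k) (A ^+ k).
Proof.
move=> N0; elim: k => [|k IH]; rewrite /spow /=.
  by rewrite muln0 expr0 (sconst_laurent 1 N0) rmorph1.
by rewrite -/(spow _ _) IH smul_laurent // mulnS exprS.
Qed.

Lemma laurent_puiseux N M A : (0 < N)%N -> puiseux (laurent N M A).
Proof.
move=> N0; exists N; split => //; exists (- M%:Z) => q q0.
have [k ->] : exists k, q = expo N M k.
  apply: contrapT => nq; move/eqP: q0; apply; apply: laurent_eq0 => // k qk.
  by case: nq; exists k.
exists (k%:Z - M%:Z); split; last by rewrite lerBrDl subrr.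
by rewrite /expo rmorphB.
Qed.

Lemma laurent_ord N M A q : (0 < N)%N -> laurent N M A q != 0 ->
  (forall q', q' < q -> laurent N M A q' = 0) ->
  exists2 k, hasord A k & q = expo N M k.
Proof.
move=> N0 q0 qmin; have [k qk] : exists k, q = expo N M k.
  apply: contrapT => nq; move/eqP: q0; apply; apply: laurent_eq0 => // k qk.
  by case: nq; exists k.
exists k => //; split.
  by move: q0; rewrite qk laurentE // => /eqP.
by move=> j jk; rewrite -(laurentE M A j N0) qmin // qk ltr_expo.
Qed.

Lemma ord_laurent N M A k : (0 < N)%N -> hasord A k ->
  laurent N M A (expo N M k) != 0 /\
  forall q', q' < expo N M k -> laurent N M A q' = 0.
Proof.
move=> N0 [Ak kmin]; split; first by rewrite laurentE //; exact/eqP.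
by move=> q' q'k; apply: laurent_eq0 => // l ql; apply: kmin; rewrite -(ltr_expo M _ _ N0) -ql.
Qed.

(** Every multiple [N'] of a denominator and every large [M] are allowed, so that finitely many
    series can share both. The evenness clause prepares the later square root. *)
Lemma puiseux_laurent (a : series R) : puiseux a ->
  exists N m, (0 < N)%N /\ forall N' M, (0 < N')%N -> (N %| N')%N -> (m * N' <= M)%N ->
    exists2 A, a = laurent N' M A & (2 * N %| N')%N -> ~~ odd M -> fps_even A.
Proof.
move=> [N [N0 [m am]]]; exists N, `|m|%N; split => // N' M N'0 NN' mM.
exists (FPS (fun k => a (expo N' M k))).
  apply: laurent_eq => // q nq; apply/eqP/negPn/negP => /am[k [qk mk]].
  have NN'r : N'%:R = (N' %/ N)%:R * N%:R :> rat by rewrite -natrM divnK.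
  have N0r : N%:R != 0 :> rat by rewrite pnatr_eq0 -lt0n.
  have N'0r : N'%:R != 0 :> rat by rewrite pnatr_eq0 -lt0n.
  (* The index is non-negative because [k >= -|m|], [N' / N <= N'] and [|m| N' <= M]. *)
  have [l lE] : exists l : nat, k * (N' %/ N)%:Z + M%:Z = l%:Z.
    suff : 0 <= k * (N' %/ N)%:Z + M%:Z by case: (_ + _) => // l _; exists l.
    have {mM}mM : `|m|%N%:Z * N'%:Z <= M%:Z by rewrite -PoszM lez_nat.
    have : - `|m|%N%:Z <= k by apply: le_trans mk; rewrite abszE lerNl ler_normr lexx orbT.
    have dN : (N' %/ N)%:Z <= N'%:Z by rewrite lez_nat leq_div.
    move=> mk'; rewrite -lerBlDr sub0r; apply: le_trans (_ : - (`|m|%N%:Z * N'%:Z) <= _).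
      by rewrite lerN2.
    apply: le_trans (_ : - `|m|%N%:Z * (N' %/ N)%:Z <= _).
      by rewrite mulNr lerN2 ler_wpM2l.
    by rewrite ler_wpM2r.
  apply: (nq l); rewrite /expo qk; apply/eqP; rewrite eqr_div //.
  have -> : l%:R = k%:~R * (N' %/ N)%:R + M%:R :> rat.
    by rewrite -[l%:R]/(l%:Z%:~R) -lE rmorphD rmorphM.
  by rewrite addrK NN'r mulrA.
(* If [(k - M) / N'] is a multiple of [1 / N], then [k - M] is a multiple of the even number
   [N' / N]; this is impossible for odd [k] and even [M]. *)
move=> NN2 Me k ko /=; apply/eqP/negPn/negP => /am[l [/eqP qk _]].
have N0r : N%:R != 0 :> rat by rewrite pnatr_eq0 -lt0n.
have N'0r : N'%:R != 0 :> rat by rewrite pnatr_eq0 -lt0n.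
move: qk; rewrite /expo eqr_div //; case/dvdnP: NN2 => d ->.
rewrite !natrM -subr_eq0.
have -> : (k%:R - M%:R) * N%:R - l%:~R * (d%:R * (2 * N%:R)) =
  (k%:R - M%:R - l%:~R * (d%:R * 2)) * N%:R :> rat by ring.
rewrite mulf_eq0 (negbTE N0r) orbF => /eqP klM.
have : k%:Z - M%:Z - l * d%:Z * 2 = 0.
  by apply: (@intr_inj rat); rewrite !(rmorphB, rmorphM) -mulrA.
move: (l * _) => z; lia.
Qed.

End LaurentSeries.

(** * Polynomials and the ideal of the variety *)

Section Polynomials.
Variables (R : realType) (n : nat).
Implicit Types (f g : cpoly n R).

Definition mdegree (e : {ffun pairs n -> nat}) : nat := (\sum_s e s)%N.

(** A term of degree [e] has pole bound [M e]; the factor [X^(M (d - e))] raises it to the common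
    bound [M d]. *)
Lemma evalK_laurent N M d f (A : pairs n -> fps (Cx R)) : (0 < N)%N ->
  all (fun t => mdegree t.2 <= d)%N f ->
  evalK f (fun s => laurent N M (A s)) = laurent N (M * d)
    (\sum_(t <- f) fps_poly t.1%:P * fps_poly 'X^(M * (d - mdegree t.2)) *
       \prod_s A s ^+ t.2 s).
Proof.
move=> N0; elim: f => [|t f IH] /=; first by rewrite big_nil -szero_laurent.
move=> /andP[td fd]; rewrite IH // big_cons -sadd_laurent.
congr (sadd _ _).
have -> : \big[@smul R/sconst 1]_s spow (laurent N M (A s)) (t.2 s) =
    laurent N (M * mdegree t.2) (\prod_s A s ^+ t.2 s).
  apply: (big_ind3 (fun a B k => a = laurent N (M * k) B)).
  - by rewrite muln0 (sconst_laurent 1 N0) rmorph1.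
  - by move=> a B k a' B' k' -> ->; rewrite smul_laurent // mulnDr.
  - by move=> s _; rewrite spow_laurent.
rewrite (sconst_laurent _ N0) smul_laurent // add0n.
rewrite [LHS](@laurent_shift R N _ (M * (d - mdegree t.2))) //.
by rewrite -mulnDr subnKC // mulrCA mulrA.
Qed.

(** Evaluation in any ring receiving the coefficients, so that one computation serves for complex
    numbers and power series alike. *)
Definition meval (S : comNzRingType) (c : Cx R -> S) f (A : pairs n -> S) : S :=
  \sum_(t <- f) c t.1 * \prod_s A s ^+ t.2 s.

Definition homog d f := all (fun t => mdegree t.2 == d) f.

Lemma evalK_homog N M d f (A : pairs n -> fps (Cx R)) : (0 < N)%N -> homog d f ->
  evalK f (fun s => laurent N M (A s)) =
    laurent N (M * d) (meval (fun c => fps_poly c%:P) f A).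
Proof.
move=> N0 hf; rewrite (evalK_laurent (d := d) _ _ N0); last first.
  by apply: sub_all hf => t /eqP ->.
congr (laurent _ _ _); rewrite /meval big_seq [RHS]big_seq; apply: eq_bigr => t.
by move/(allP hf)/eqP => ->; rewrite subnn muln0 rmorph1 mulr1.
Qed.

(** * Arithmetic of polynomials given as term lists, and the Gram minors *)

Definition cp_var (s : pairs n) : cpoly n R := [:: (1, [ffun s' => (s' == s) : nat])].
Definition cp_opp f : cpoly n R := [seq (- t.1, t.2) | t <- f].
Definition cp_mul f g : cpoly n R :=
  [seq (t.1 * u.1, [ffun s => (t.2 s + u.2 s)%N]) |
    t : Cx R * {ffun pairs n -> nat} <- f, u : Cx R * {ffun pairs n -> nat} <- g].

Section Meval.
Variables (S : comNzRingType) (c : {rmorphism Cx R -> S}) (A : pairs n -> S).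

Lemma meval_nil : meval c [::] A = 0.
Proof. exact: big_nil. Qed.

Lemma meval_var s : meval c (cp_var s) A = A s.
Proof.
rewrite /meval big_seq1 rmorph1 mul1r (bigD1 s) //= ffunE eqxx expr1.
by rewrite big1 ?mulr1 // => s' /negbTE s's; rewrite ffunE s's.
Qed.

Lemma meval_cat f g : meval c (f ++ g) A = meval c f A + meval c g A.
Proof. exact: big_cat. Qed.

Lemma meval_opp f : meval c (cp_opp f) A = - meval c f A.
Proof.
by rewrite /meval big_map -sumrN; apply: eq_bigr => t _; rewrite rmorphN mulNr.
Qed.

Lemma meval_mul f g : meval c (cp_mul f g) A = meval c f A * meval c g A.
Proof.
rewrite /meval big_allpairs_dep mulr_suml; apply: eq_bigr => t _ /=.
rewrite mulr_sumr; apply: eq_bigr => u _ /=; rewrite rmorphM mulrACA; congr (_ * _).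
by rewrite -big_split; apply: eq_bigr => s _; rewrite ffunE exprD.
Qed.
End Meval.

Lemma homog_var s : homog 1 (cp_var s).
Proof.
rewrite /homog /= andbT /mdegree (bigD1 s) //= ffunE eqxx big1 ?addn0 //.
by move=> s' /negbTE s's; rewrite ffunE s's.
Qed.
Lemma homog_cat d f g : homog d f -> homog d g -> homog d (f ++ g).
Proof. by rewrite /homog all_cat => -> ->. Qed.
Lemma homog_opp d f : homog d f -> homog d (cp_opp f).
Proof. by rewrite /homog all_map. Qed.
Lemma homog_mul d d' f g : homog d f -> homog d' g -> homog (d + d') (cp_mul f g).
Proof.
move=> hf hg; apply/allP => _ /allpairsP[[t u] [/(allP hf)/eqP <- /(allP hg)/eqP <- ->]] /=.
by rewrite /mdegree -big_split /=; apply/eqP/eq_bigr => s _; rewrite ffunE.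
Qed.

Lemma pval_map (T T' : Type) (h : T -> T') d0 (x : pairs n -> T) (u v : 'I_n) :
  pval (h d0) (fun s => h (x s)) u v = h (pval d0 x u v).
Proof. by rewrite /pval; case: insub => // ; case: insub. Qed.

Lemma pvalxx (T : Type) (d0 : T) (x : pairs n -> T) u : pval d0 x u u = d0.
Proof. by rewrite /pval insubF /= ?ltnn. Qed.

Lemma pval_val (T : Type) (d0 : T) (x : pairs n -> T) s :
  pval d0 x (val s).1 (val s).2 = x s.
Proof. by rewrite /pval -surjective_pairing valK. Qed.

Lemma pvalE (T : Type) (d0 : T) (g : 'I_n -> 'I_n -> T) (x : pairs n -> T) u v :
  (forall s, x s = g (val s).1 (val s).2) ->
  (forall u v, g u v = g v u) -> u != v -> pval d0 x u v = g u v.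
Proof.
move=> xg gC uv; rewrite /pval; case: insubP => [s _ sE|]; first by rewrite xg sE.
case: insubP => [s _ sE|/=]; first by rewrite xg sE gC.
by rewrite -!leqNgt => h1 h2; move: uv; rewrite -val_eqE eqn_leq h1 h2.
Qed.

Lemma pvalE0 (V : zmodType) (g : 'I_n -> 'I_n -> V) (x : pairs n -> V) u v :
  (forall s, x s = g (val s).1 (val s).2) ->
  (forall u v, g u v = g v u) -> (forall u, g u u = 0) -> pval 0 x u v = g u v.
Proof.
move=> xg gC g0; have [->|] := eqVneq u v; first by rewrite pvalxx g0.
exact: pvalE.
Qed.

Lemma pvalC (T : Type) (d0 : T) (x : pairs n -> T) u v : pval d0 x u v = pval d0 x v u.
Proof.
rewrite /pval; case: insubP => [s /= uv _|]; case: insubP => //.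
by move=> s' /= vu _; move: (ltn_trans uv vu); rewrite ltnn.
Qed.

(* Twice the inner product of p_u - p_o and p_v - p_o, when x gives the squared
   distances; these vectors lie in a plane, so the 3x3 minors vanish. *)
Definition gram (V : zmodType) (x : pairs n -> V) (o u v : 'I_n) : V :=
  pval 0 x u o + pval 0 x v o - pval 0 x u v.

(** The determinant on rows [a], [i], [k] and columns [b], [j], [l], expanded along the first
    row. *)
Definition minor3 (S : comNzRingType) (G : 'I_n -> 'I_n -> S) (a i k b j l : 'I_n) : S :=
  G a b * (G i j * G k l - G i l * G k j)
  - G a j * (G i b * G k l - G i l * G k b)
  + G a l * (G i b * G k j - G i j * G k b).

(** The default [[::]] is the zero polynomial, the squared distance from a point to itself. *)
Definition cp_dist u v : cpoly n R := pval [::] cp_var u v.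
Definition cp_gram (o u v : 'I_n) : cpoly n R :=
  cp_dist u o ++ cp_dist v o ++ cp_opp (cp_dist u v).

Definition cp_minor3 (o a i k b j l : 'I_n) : cpoly n R :=
  let G := cp_gram o in
  let det2 f11 f12 f21 f22 := cp_mul f11 f22 ++ cp_opp (cp_mul f12 f21) in
  cp_mul (G a b) (det2 (G i j) (G i l) (G k j) (G k l))
  ++ cp_opp (cp_mul (G a j) (det2 (G i b) (G i l) (G k b) (G k l)))
  ++ cp_mul (G a l) (det2 (G i b) (G i j) (G k b) (G k j)).

Lemma homog_minor3 o a i k b j l : homog 3 (cp_minor3 o a i k b j l).
Proof.
have hd u v : homog 1 (cp_dist u v).
  rewrite /cp_dist /pval; case: insub => [s|]; first exact: homog_var.
  by case: insub => [s|] //; exact: homog_var.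
have hG u v : homog 1 (cp_gram o u v) by rewrite !homog_cat ?homog_opp.
by rewrite !(homog_cat, homog_opp) // -[3%N]/(1 + 2)%N;
   rewrite !(homog_mul, homog_cat, homog_opp) // -[2%N]/(1 + 1)%N homog_mul.
Qed.

Lemma meval_minor3 (S : comNzRingType) (c : {rmorphism Cx R -> S}) A o a i k b j l :
  meval c (cp_minor3 o a i k b j l) A = minor3 (gram A o) a i k b j l.
Proof.
have md u v : meval c (cp_dist u v) A = pval 0 A u v.
  rewrite -(pval_map (fun f => meval c f A)) meval_nil; congr (pval _ _ u v).
  by apply/funext => s; rewrite meval_var.
have mG u v : meval c (cp_gram o u v) A = gram A o u v.
  by rewrite !meval_cat meval_opp !md addrA.
rewrite /cp_minor3; move: (cp_gram o) mG => G mG.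
by rewrite !(meval_cat, meval_opp, meval_mul) !mG /minor3 addrA.
Qed.

Lemma minor3_in_ideal o a i k b j l : in_ideal_PG (cp_minor3 o a i k b j l).
Proof.
move=> p; rewrite -[LHS]/(meval (@idfun (Cx R)) _ _) meval_minor3.
pose x u : Cx R := (((p u).1 - (p o).1)%:C)%C.
pose y u : Cx R := (((p u).2 - (p o).2)%:C)%C.
have G u v : gram (sqdist2 p) o u v = 2 * (x u * x v + y u * y v).
  pose g u v : Cx R := (x u - x v) ^+ 2 + (y u - y v) ^+ 2.
  have D u' v' : pval 0 (sqdist2 p) u' v' = g u' v'.
    apply: pvalE0 => [s|u1 v1|u1].
    - by rewrite /sqdist2 /g /x /y -!rmorphB !opprB !addrA !subrK -!rmorphXn -rmorphD.
    - by rewrite /g -sqrrN opprB -[X in _ + X = _]sqrrN opprB.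
    - by rewrite /g !subrr expr0n addr0.
  rewrite /gram !D /g /x /y !subrr rmorph0; ring.
rewrite /minor3 !G; move: x y {G} => x y; ring.
Qed.

(** * From real points to complex points and to Puiseux points *)

(** The test points are real, so that the real parametrization applies, and non-zero, so that
    negative powers of them make sense. *)
Lemma poly_nat_eq0 (p : {poly Cx R}) : (forall m : nat, p.[m.+1%:R] = 0) -> p = 0.
Proof.
move=> p0; apply/eqP/negPn/negP => pn0.
pose r : seq (Cx R) := [seq m.+1%:R | m <- iota 0 (size p)].
have r0 : all (root p) r by apply/allP => _ /mapP[m _ ->]; rewrite rootE p0.
have ur : uniq r.
  by rewrite map_inj_uniq ?iota_uniq // => a b /eqP; rewrite eqr_nat eqSS => /eqP.
by have := max_poly_roots pn0 r0 ur; rewrite size_map size_iota ltnn.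
Qed.

(* Every complex point lies on the complexified line through two real points. *)
Lemma in_ideal_complex f (a b : 'I_n -> Cx R) : in_ideal_PG f ->
  evalC f (fun s => (a (val s).1 - a (val s).2) * (b (val s).1 - b (val s).2)) = 0.
Proof.
move=> If.
pose x u : Cx R := (a u + b u) / 2; pose y u : Cx R := (a u - b u) / (2 * 'i%C).
(* [X u] and [Y u] are real at real arguments and equal [x u] and [y u] at [i]. So [P] vanishes at
   all [m.+1], hence identically, hence at [i]. *)
pose X u : {poly Cx R} := (((complex.Re (x u))%:C)%C)%:P + (((complex.Im (x u))%:C)%C)%:P * 'X.
pose Y u : {poly Cx R} := (((complex.Re (y u))%:C)%C)%:P + (((complex.Im (y u))%:C)%C)%:P * 'X.
have XE u z : (X u).[z] = ((complex.Re (x u))%:C)%C + ((complex.Im (x u))%:C)%C * z.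
  by rewrite !hornerE.
have YE u z : (Y u).[z] = ((complex.Re (y u))%:C)%C + ((complex.Im (y u))%:C)%C * z.
  by rewrite !hornerE.
pose P := meval polyC f (fun s => (X (val s).1 - X (val s).2) ^+ 2 +
                                  (Y (val s).1 - Y (val s).2) ^+ 2).
have PE z : P.[z] = evalC f (fun s => ((X (val s).1).[z] - (X (val s).2).[z]) ^+ 2 +
                                  ((Y (val s).1).[z] - (Y (val s).2).[z]) ^+ 2).
  rewrite /P /meval horner_sum; apply: eq_bigr => t _.
  rewrite hornerM hornerC horner_prod; congr (_ * _); apply: eq_bigr => s _.
  by rewrite horner_exp !hornerE.
have P0 : P = 0.
  apply: poly_nat_eq0 => m; rewrite PE.
  rewrite -[RHS](If (fun u => (complex.Re (x u) + complex.Im (x u) * m.+1%:R,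
                     complex.Re (y u) + complex.Im (y u) * m.+1%:R))).
  congr evalC; apply/funext => s; rewrite /sqdist2 !XE !YE.
  have mE : m.+1%:R = (m.+1%:R%:C)%C :> Cx R by rewrite rmorph_nat.
  by rewrite mE -!(rmorphM, rmorphD, rmorphB, rmorphXn).
transitivity P.['i%C]; last by rewrite P0 horner0.
rewrite PE; congr evalC; apply/funext => s.
have Xi u : (X u).['i%C] = x u by rewrite XE [RHS]complexE mulrC.
have Yi u : (Y u).['i%C] = y u by rewrite YE [RHS]complexE mulrC.
rewrite !Xi !Yi /x /y; have i2 : ('i%C : Cx R) ^+ 2 = -1 by exact: sqr_i.
have i0 : ('i%C : Cx R) != 0.
  by apply/eqP => i0; move/eqP: i2; rewrite i0 expr0n eq_sym oppr_eq0 oner_eq0.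
have two0 : (2 : Cx R) != 0 by rewrite pnatr_eq0.
have id (a1 a2 b1 b2 : Cx R) : ((a1 + b1) / 2 - (a2 + b2) / 2) ^+ 2 +
    ((a1 - b1) / (2 * 'i%C) - (a2 - b2) / (2 * 'i%C)) ^+ 2 = (a1 - a2) * (b1 - b2).
  have -> : (a1 - b1) / (2 * 'i%C) - (a2 - b2) / (2 * 'i%C) =
            (a1 - b1 - a2 + b2) / 2 / ('i%C : Cx R) by field; rewrite ?two0 ?i0.
  by rewrite expr_div_n i2; field.
by rewrite id.
Qed.

(** Substituting a non-zero complex number [z] for the parameter [s] gives a complex point of the
    variety; a polynomial in [s] that vanishes at infinitely many [z] is zero. *)
Lemma poly_PG_K f N M (a b : 'I_n -> {poly Cx R}) : (0 < N)%N -> in_ideal_PG f ->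
  evalK f (fun s => laurent N M
    (fps_poly ((a (val s).1 - a (val s).2) * (b (val s).1 - b (val s).2)))) = szero R.
Proof.
move=> N0 If; pose d := (\sum_(t <- f) mdegree t.2)%N.
rewrite (evalK_laurent (d := d) _ _ N0); last first.
  by apply/allP => t tf; rewrite /d (big_rem t) //= leq_addr.
set Q := \sum_(t <- f) _; suff -> : Q = 0 by rewrite -szero_laurent.
pose q (s : pairs n) := (a (val s).1 - a (val s).2) * (b (val s).1 - b (val s).2).
pose P : {poly Cx R} := \sum_(t <- f) t.1%:P * 'X^(M * (d - mdegree t.2)) *
  \prod_s q s ^+ t.2 s.
have -> : Q = fps_poly P.
  rewrite rmorph_sum; apply: eq_bigr => t _; rewrite !rmorphM rmorph_prod /=.
  by congr (_ * _); apply: eq_bigr => s _; rewrite rmorphXn.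
suff -> : P = 0 by rewrite rmorph0.
apply: poly_nat_eq0 => m; set z := m.+1%:R.
have z0 : z != 0 by rewrite pnatr_eq0.
(* [P] is [f] with the denominators [z^M] of the coordinates cleared; these denominators are then
   absorbed into [a]. *)
transitivity (z ^+ (M * d) * evalC f (fun s => z ^- M * (q s).[z])); last first.
  rewrite [X in _ * X](_ : _ = 0) ?mulr0 //.
  rewrite -[RHS](in_ideal_complex (fun u => z ^- M * (a u).[z]) (fun u => (b u).[z]) If).
  by congr evalC; apply/funext => s; rewrite /q hornerM !hornerD !hornerN -mulrBr mulrA.
rewrite horner_sum mulr_sumr big_seq [RHS]big_seq; apply: eq_bigr => t tf.
have td : (mdegree t.2 <= d)%N by rewrite /d (big_rem t) //= leq_addr.
rewrite !hornerM hornerC hornerXn horner_prod.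
under eq_bigr do rewrite horner_exp.
under [in RHS]eq_bigr do rewrite exprMn.
rewrite big_split /= prodrXr -/(mdegree t.2); set W := \prod_s _.
have -> : z ^+ (M * (d - mdegree t.2)) = z ^+ (M * d) * z ^- M ^+ mdegree t.2.
  by rewrite exprVn -exprM -[in RHS](subnK td) mulnDr exprD mulfK // expf_neq0.
by rewrite !mulrA [in LHS](mulrC t.1).
Qed.

End Polynomials.

(** * Closedness of the Minkowski sum *)

Section FourierMotzkin.
Variable R : realFieldType.

(** The largest lower bound serves; without lower bounds the smallest upper bound does, and without
    either 0. *)
Lemma between_finite (I : finType) (P Q : pred I) (lo hi : I -> R) :
  (forall p q, P p -> Q q -> lo q <= hi p) ->
  exists x, (forall p, P p -> x <= hi p) /\ (forall q, Q q -> lo q <= x).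
Proof.
move=> lohi; case: (pickP Q) => [q0 Qq0|Q0].
  exists (lo [arg max_(q > q0 | Q q) lo q]%O).
  by case: arg_maxP => // q Qq qmax; split => [p Pp|q' /qmax //]; exact: lohi.
case: (pickP P) => [p0 Pp0|P0].
  exists (hi [arg min_(p < p0 | P p) hi p]%O).
  by case: arg_minP => // p Pp pmin; split => [p' /pmin //|q]; rewrite Q0.
by exists 0; split => [p|q]; rewrite ?P0 ?Q0.
Qed.

(* Fourier-Motzkin elimination: projections of polyhedra are closed. *)
Lemma approx_solvable (V : eqType) (r : seq V) (I : finType)
    (a : I -> V -> R) (c : I -> R) : uniq r ->
  (forall e, 0 < e -> exists d, forall i, \sum_(s <- r) a i s * d s <= c i + e) ->
  exists d, forall i, \sum_(s <- r) a i s * d s <= c i.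
Proof.
elim: r I a c => [|m r IH] I a c /=.
  move=> _ H; exists (fun=> 0) => i; rewrite big_nil; apply/ler_addgt0Pr => e e0.
  by have [d /(_ i)] := H e e0; rewrite big_nil.
move=> /andP[mr ur] H.
(* Constraints left after eliminating [m]: those in which [m] does not occur, and for each upper
   bound [p] and lower bound [q] on [m] the positive combination cancelling [m]. All other indices
   are switched off to [0 <= 0]. *)
pose J := (I + I * I)%type.
pose on (j : J) := match j with
  | inl p => a p m == 0 | inr (p, q) => (0 < a p m) && (a q m < 0) end.
pose a' (j : J) s := if on j then match j with
  | inl p => a p s | inr (p, q) => a p m * a q s - a q m * a p s end else 0.
pose c' (j : J) := if on j then match j with
  | inl p => c p | inr (p, q) => a p m * c q - a q m * c p end else 0.
have sum' (d : V -> R) p q : \sum_(s <- r) (a p m * a q s - a q m * a p s) * d s =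
    a p m * (\sum_(s <- r) a q s * d s) - a q m * (\sum_(s <- r) a p s * d s).
  by rewrite !mulr_sumr -sumrB; apply: eq_bigr => s _; rewrite mulrBl !mulrA.
have off d j : on j = false -> \sum_(s <- r) a' j s * d s = 0.
  by move=> oj; rewrite big1 // => s _; rewrite /a' oj mul0r.
have [] := IH J a' c' ur.
  (* [B] bounds every coefficient of [m], so combining two constraints with error [e / (2 B)] gives
     an error of at most [e]. *)
  move=> e e0; pose B := 1 + \sum_i `|a i m|.
  have B1 : 1 <= B by rewrite lerDl sumr_ge0.
  have aB i : `|a i m| <= B.
    by rewrite /B (bigD1 i) //= addrCA lerDl addr_ge0 // sumr_ge0.
  pose e' := e / (2 * B).
  have eE : e = 2 * B * e' by rewrite /e'; field; lra.
  have e'0 : 0 < e' by rewrite divr_gt0 // mulr_gt0 //; lra.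
  have [d dP] := H e' e'0; exists d => j; case oj: (on j); last first.
    by rewrite off // /c' oj add0r ltW.
  rewrite /c' /a' oj; case: j oj => [p /= /eqP pm|[p q] /= /andP[pm qm]].
    have := dP p; rewrite big_cons pm mul0r add0r => /le_trans; apply.
    rewrite lerD2l eE ler_peMl ?(ltW e'0) //; lra.
  rewrite sum'; have := dP p; have := dP q; rewrite !big_cons.
  move: (\sum_(s <- r) _) (\sum_(s <- r) _) => Lq Lp.
  have := aB p; have := aB q; rewrite (gtr0_norm pm) (ltr0_norm qm) => qB pB Hq Hp.
  have h1 := ler_wpM2l (ltW pm) Hq.
  have nq : 0 <= - a q m by lra.
  have h2 := ler_wpM2l nq Hp.
  have h3 : a p m * e' <= B * e' by rewrite ler_wpM2r // ltW.
  have h4 : - a q m * e' <= B * e' by rewrite ler_wpM2r // ltW.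
  rewrite eE; nra.
move=> d dP.
pose L i := \sum_(s <- r) a i s * d s.
have [|x [xhi xlo]] := @between_finite I (fun p => 0 < a p m) (fun q => a q m < 0)
    (fun q => (c q - L q) / a q m) (fun p => (c p - L p) / a p m).
  move=> p q pm qm; have := dP (inr (p, q)); rewrite /a' /c' /= pm qm /= sum' -!/(L _).
  move=> h; rewrite ler_pdivlMr // mulrAC ler_ndivrMr //; lra.
exists (fun s => if s == m then x else d s) => i; rewrite big_cons eqxx.
have -> : \sum_(s <- r) a i s * (if s == m then x else d s) = L i.
  rewrite /L big_seq [RHS]big_seq; apply: eq_bigr => s sr; case: eqP => // sm.
  by move: mr; rewrite -sm sr.
case: (ltrgtP (a i m) 0) => im.
- by have := xlo i im; rewrite ler_ndivrMr //; lra.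
- by have := xhi i im; rewrite ler_pdivlMr //; lra.
- by have := dP (inl i); rewrite /a' /c' /= im eqxx -/(L _); lra.
Qed.

End FourierMotzkin.

(** * Ultrametrics as a finite union of polyhedral cones *)

Section ClosedSum.
Variables (R : realType) (n : nat).

(** If each [c] failed at some positive error, monotonicity would make all of them fail at the
    minimum of these finitely many errors. *)
Lemma finite_choice (C : finType) (P : C -> R -> Prop) :
  (forall c e e', P c e -> e <= e' -> P c e') ->
  (forall e, 0 < e -> exists c, P c e) -> exists c, forall e, 0 < e -> P c e.
Proof.
move=> Pmono Pex; apply: contrapT => /forallNP nP.
have /choice[e eP] : forall c, exists e, 0 < e /\ ~ P c e.
  move=> c; have /existsNP[e /not_implyP[e0 nPe]] := nP c; by exists e.
pose e0 := \big[Order.min/1]_c e c.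
have e00 : 0 < e0.
  by rewrite /e0; elim/big_ind: _ => // [x y x0 y0|c _]; [rewrite lt_min x0|case: (eP c)].
have [c /Pmono Pc] := Pex _ e00; have [_] := eP c; apply; apply: Pc.
exact: bigmin_le_cond.
Qed.

Lemma pval_coef (d : pairs n -> R) u v :
  \sum_s pval 0 (fun s' => (s' == s)%:R) u v * d s = pval 0 d u v.
Proof.
have E s0 : \sum_s (s0 == s)%:R * d s = d s0.
  rewrite (bigD1 s0) //= eqxx mul1r big1 ?addr0 // => s.
  by rewrite eq_sym => /negbTE ->; rewrite mul0r.
rewrite /pval; case: insub => [s0|]; first exact: E.
case: insub => [s0|]; first exact: E.
by rewrite big1 // => s _; rewrite mul0r.
Qed.

Lemma pval_add (d d' : pairs n -> R) u v :
  pval 0 (fun s => d s + d' s) u v = pval 0 d u v + pval 0 d' u v.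
Proof. by rewrite /pval; case: insub => // ; case: insub => //; rewrite addr0. Qed.

Lemma pval_lt (d d' : pairs n -> R) e u v : 0 < e ->
  (forall s, `|d s - d' s| < e) -> `|pval 0 d u v - pval 0 d' u v| < e.
Proof.
by move=> e0 H; rewrite /pval; case: insub => // ; case: insub => //; rewrite subrr normr0.
Qed.

Lemma minkowski_U_closed :
  (eclosure (minkowski (@U_ R n) (@U_ R n)) `<=` minkowski (@U_ R n) (@U_ R n))%classic.
Proof.
move=> w wcl.
pose T := ('I_n * 'I_n * 'I_n)%type.
pose dist (t : T) := let: (u, v, z) := t in [&& u != v, v != z & u != z].
(* A choice of the dominating term in each of the maxima. *)
pose diff (b : {ffun T -> bool}) (t : T) (d : pairs n -> R) :=
  let: (u, v, z) := t in pval 0 d u v - (if b t then pval 0 d u z else pval 0 d v z).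
pose C := ({ffun T -> bool} * {ffun T -> bool})%type.
(* Up to [e], [d] lies in the cone chosen by [c.1] and [w - d] in the cone chosen by [c.2]. *)
pose P (c : C) e := exists d, forall t, dist t ->
  diff c.1 t d <= e /\ - diff c.2 t d <= - diff c.2 t w + e.
have diffE b t d : \sum_s diff b t (fun s' => (s' == s)%:R) * d s = diff b t d.
  case: t => [[u v] z]; rewrite /diff; under eq_bigr do rewrite mulrBl.
  rewrite sumrB pval_coef; congr (_ - _).
  by case: (b _); rewrite -[RHS]pval_coef.
pose best (d : pairs n -> R) : {ffun T -> bool} :=
  [ffun t => let: (u, v, z) := t in pval 0 d v z <= pval 0 d u z].
have bestP d t : U_ d -> dist t -> diff (best d) t d <= 0.
  case: t => [[u v] z] dU /and3P[uv vz uz]; rewrite /diff ffunE subr_le0.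
  have := dU u v z uv vz uz; rewrite le_max.
  by case: (leP (pval 0 d v z)) => h /orP[] // h';
     [exact: le_trans h' h | exact: le_trans h' (ltW h)].
have Ubest b d : (forall t, dist t -> diff b t d <= 0) -> U_ d.
  move=> H u v z uv vz uz; have := H (u, v, z); rewrite /= uv vz uz => /(_ isT).
  by rewrite /diff subr_le0 le_max; case: (b _) => ->; rewrite ?orbT.
have [| |c cP] := @finite_choice C P.
- move=> c e e' [d dP] ee'; exists d => t /dP[h1 h2]; split; first exact: le_trans h1 ee'.
  by apply: le_trans h2 _; rewrite lerD2l.
(* Each inequality compares two coordinates, so an approximation within [e / 2] suffices. *)
- move=> e e0; have e20 : 0 < e / 2 by rewrite divr_gt0.
  have [v [[d [d' [dU [d'U vE]]]] wv]] := wcl _ e20.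
  exists (best d, best d'), d => t dt; split.
    by apply: le_trans (bestP d t dU dt) _; exact: ltW.
  have := bestP d' t d'U dt; move: (best d') => b /=; rewrite /diff; case: t {dt} => [[u y] z].
  have wvd x1 x2 : `|pval 0 w x1 x2 - (pval 0 d x1 x2 + pval 0 d' x1 x2)| < e / 2.
    by rewrite -pval_add -vE; exact: pval_lt.
  have := wvd u y; have := wvd u z; have := wvd y z.
  rewrite !ltr_norml => /andP[h1 h2] /andP[h3 h4] /andP[h5 h6].
  case: (b _) => h; lra.
(* The boolean tells the inequality on [d] from the one on [w - d]; triples with repeated points
   give [0 <= 0]. *)
pose a (i : T * bool) s : R := let: (t, k) := i in if dist t then
  (if k then diff c.1 t (fun s' => (s' == s)%:R) else - diff c.2 t (fun s' => (s' == s)%:R)) else 0.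
pose r (i : T * bool) : R := let: (t, k) := i in if dist t then
  (if k then 0 else - diff c.2 t w) else 0.
have aE i d : \sum_(s : pairs n) a i s * d s = let: (t, k) := i in if dist t then
  (if k then diff c.1 t d else - diff c.2 t d) else 0.
  case: i => t k; rewrite /a; case: (dist t); last by rewrite big1 // => s _; rewrite mul0r.
  case: k; first exact: diffE.
  by rewrite -diffE -sumrN; apply: eq_bigr => s _; rewrite mulNr.
have [|e e0|d dP] := @approx_solvable R (pairs n) (index_enum (pairs n)) _ a r.
- exact: index_enum_uniq.
- have [d dP] := cP e e0; exists d => -[t k]; rewrite aE /r.
  case dt: (dist t); last by rewrite add0r ltW.
  by have [h1 h2] := dP t dt; case: k => //; rewrite add0r.
have {}dP t : dist t -> diff c.1 t d <= 0 /\ diff c.2 t w <= diff c.2 t d.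
  move=> dt; have := dP (t, true); have := dP (t, false).
  by rewrite !aE /r dt lerN2.
exists d, (fun s => w s - d s); split; [|split].
- by apply: (Ubest c.1) => t /dP[].
- apply: (Ubest c.2) => t /dP[_].
  have pB u v : pval 0 (fun s => w s - d s) u v = pval 0 w u v - pval 0 d u v.
    by rewrite /pval; case: insub => // ; case: insub => //; rewrite subrr.
  case: t => [[u v] z]; rewrite /diff !pB; case: (c.2 _); lra.
- by apply/funext => s; rewrite addrC subrK.
Qed.

End ClosedSum.

(** * Realizing ultrametrics *)

Section Realization.
Variables (R : realType) (n : nat).

(** By the ultrametric inequality the balls of radius [k] around [u] and [v] coincide for
    [k < D u v] and differ at [k = D u v]. Distinct labels stay distinct in characteristic zero. *)
Lemma realize_orders (F : numFieldType) (D : 'I_n -> 'I_n -> nat) :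
  (forall u v, D u v = D v u) ->
  (forall u v w, u != v -> v != w -> u != w -> (minn (D u w) (D v w) <= D u v)%N) ->
  exists a : 'I_n -> {poly F},
    forall u v, u != v -> hasord (fps_poly (a u - a v)) (D u v).
Proof.
move=> DC Dult; pose B := (\sum_u \sum_v D u v)%N.+1.
have DB u v : (D u v < B)%N.
  by rewrite ltnS (bigD1 u) //= (bigD1 v) //= -addnA leq_addr.
(* The k-th coefficient of a u is a label for the ball of radius k around u. *)
pose ball k u := [set v | (v == u) || (k < D u v)%N].
exists (fun u => \poly_(k < B) (enum_rank (ball k u))%:R) => u v uv; split.
  rewrite /= coefB !coef_poly DB; apply/eqP; rewrite subr_eq0 eqr_nat.
  apply/eqP => /val_inj/enum_rank_inj/setP/(_ v).
  by rewrite !inE eqxx ltnn orbF eq_sym (negbTE uv).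
move=> k kD; rewrite /= coefB !coef_poly (ltn_trans kD) ?DB //.
suff -> : ball k u = ball k v by rewrite subrr.
apply/setP => z; rewrite !inE.
have [->|zu] := eqVneq z u; first by rewrite DC kD orbT.
have [->|zv] := eqVneq z v; first by rewrite kD orbT.
have := Dult v z u; have := Dult u z v; rewrite ![_ == z]eq_sym (eq_sym v u) uv zu zv.
move=> /(_ isT isT isT) + /(_ isT isT isT).
by rewrite (DC z v) (DC z u) (DC v u) /=; lia.
Qed.

Lemma approx_ultrametric (d : pairs n -> R) N : U_ d -> (0 < N)%N ->
  exists M (a : 'I_n -> {poly Cx R}) (D : pairs n -> nat),
    (forall s, hasord (fps_poly (a (val s).1 - a (val s).2)) (D s)) /\
    (forall s, `|d s - (M%:R - (D s)%:R) / N%:R| <= N%:R^-1).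
Proof.
move=> dU N0; pose fl u v := Num.floor (N%:R * pval 0 d u v).
(* Orders are negated valuations, so [M] is taken large enough to make every [M - fl u v] a natural
   number. *)
pose M := (\sum_u \sum_v `|fl u v|)%N.
pose D u v := `|M%:Z - fl u v|%N.
have flM u v : fl u v <= M%:Z.
  apply: le_trans (ler_norm _) _; rewrite -abszE lez_nat.
  by rewrite /M (bigD1 u) //= (bigD1 v) //= -addnA leq_addr.
have DE u v : (D u v)%:Z = M%:Z - fl u v by rewrite /D abszE ger0_norm // subr_ge0.
have N0R : 0 < N%:R :> R by rewrite ltr0n.
have [||a aP] := @realize_orders (Cx R) D.
- by move=> u v; rewrite /D /fl pvalC.
- move=> u v z uv vz uz; have := dU u v z uv vz uz.
  rewrite geq_min -!lez_nat !DE !lerD2l !lerN2 le_max => /orP[] h; apply/orP; [left|right];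
    by apply: le_floor; rewrite ler_pM2l.
exists M, a, (fun s => D (val s).1 (val s).2); split => s.
  by apply: aP; rewrite -val_eqE neq_ltn (valP s).
set u := (val s).1; set v := (val s).2.
have -> : (D u v)%:R = M%:R - (fl u v)%:~R :> R.
  by rewrite -[(D u v)%:R]/((D u v)%:Z%:~R) DE rmorphB.
have ds : pval 0 d u v = d s by exact: pval_val.
rewrite subKr /fl ds.
have := floor_le (N%:R * d s); have := floorD1_gt (N%:R * d s).
rewrite rmorphD /=; move: (Num.floor _)%:~R => f h1 h2.
have -> : d s - f / N%:R = (N%:R * d s - f) / N%:R by field; rewrite gt_eqF.
have i0 : 0 <= N%:R^-1 :> R by rewrite invr_ge0 ltW.
rewrite normrM (ger0_norm i0) ler_piMl // ger0_norm; lra.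
Qed.

Lemma minkowski_sub_trop :
  (minkowski (@U_ R n) (@U_ R n) `<=` @trop_PG R n)%classic.
Proof.
move=> _ [d [d' [dU [d'U ->]]]] e e0.
(* Each of the two ultrametrics is rounded with error at most [1 / N], so [2 / N < e] is
   required. *)
pose N := (Num.truncn (2 / e)).+1.
have N0 : (0 < N)%N by [].
have Ne : 2 * N%:R^-1 < e.
  by rewrite ltr_pdivrMr ?ltr0n // mulrC -ltr_pdivrMr // /N truncnS_gt.
have [M [a [D [aD dD]]]] := approx_ultrametric dU N0.
have [M' [b [D' [bD dD']]]] := approx_ultrametric d'U N0.
pose x (s : pairs n) := laurent N (M + M')
  (fps_poly ((a (val s).1 - a (val s).2) * (b (val s).1 - b (val s).2))).
exists (fun s => - ratr (expo N (M + M') (D s + D' s))); split.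
  exists x; split; last first.
    move=> s; exists (expo N (M + M') (D s + D' s)).
    have [|h1 h2] := ord_laurent (M + M') N0
      (A := fps_poly ((a (val s).1 - a (val s).2) * (b (val s).1 - b (val s).2)))
      (k := (D s + D' s)%N).
      by rewrite rmorphM; apply: hasordM; [exact: aD | exact: bD].
    by split.
  split => [s|f]; first exact: laurent_puiseux.
  exact: poly_PG_K.
move=> s; rewrite ratr_expo !natrD.
have := dD s; have := dD' s; move: Ne; rewrite /=.
set i := N%:R^-1; move=> Ne h1 h2.
rewrite -[_ - _](_ : (d s - (M%:R - (D s)%:R) * i) + (d' s - (M'%:R - (D' s)%:R) * i) = _).
  by apply: le_lt_trans (ler_normD _ _) _; lra.
ring.
Qed.

End Realization.

(** * Splitting points of the variety *)

Section Splitting.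
Variables (F : closedFieldType) (n : nat).
Hypothesis two_neq0 : 2 != 0 :> F.
Implicit Types x : pairs n -> fps F.

Lemma two_fps_neq0 : 2 <> 0 :> fps F.
Proof.
move/(congr1 (fun A => coefs A 0)); rewrite coef_fpsD coef_fps0 /=.
by move/eqP; rewrite (negbTE two_neq0).
Qed.

(* A symmetric matrix of rank at most two is the polarisation of a product of two
   linear forms; the square root needed to find them exists by evenness. *)
Lemma split_distances x (o p : 'I_n) : o != p ->
  (forall s, x s <> 0) -> (forall s, fps_even (x s)) ->
  (forall i k j l, minor3 (gram x o) p i k p j l = 0) ->
  exists (z : fps F) (a b : 'I_n -> fps F), z <> 0 /\
    forall u v, (a u - a v) * (b u - b v) = z * pval 0 x u v.
Proof.
move=> op x0 xeven minors; pose G := gram x o.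
have GC u v : G u v = G v u by rewrite /G /gram (pvalC _ _ u v) [X in X - _]addrC.
have Gx u v : G u u + G v v - 2 * G u v = 2 * pval 0 x u v.
  by rewrite /G /gram !pvalxx; ring.
(* [H] is [g] times the Schur complement of the entry [g] in the Gram matrix. *)
pose g := G p p; pose H u v := g * G u v - G p u * G p v.
have g0 : g <> 0.
  rewrite /g /G /gram pvalxx subr0 -mulr2n -mulr_natl.
  apply: fps_mul_neq0; first exact: two_fps_neq0.
  rewrite /pval; case: insubP => [s _ _|]; first exact: x0.
  case: insubP => [s _ _|/=]; first by move=> _; exact: x0.
  by rewrite -!leqNgt => h1 h2; case/negP: op; rewrite -val_eqE eqn_leq h1 h2.
have Gg u v : (G p u - G p v) * (G p u - G p v) =
    2 * g * pval 0 x u v - (H u u + H v v - 2 * H u v).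
  by rewrite -mulrA mulrCA -Gx /H; ring.
(* The 2x2 minors of [H] are [g] times the 3x3 minors of [G] through the entry at [p], [p], so [H]
   has rank at most one. *)
have H22 i j k l : H i j * H k l = H i l * H k j.
  apply/eqP; rewrite -subr_eq0; apply/eqP.
  rewrite -[RHS](mulr0 g) -(minors i k j l) /minor3 -/G /H (GC i p) (GC k p) -/g; ring.
have HC u v : H u v = H v u by rewrite /H GC [X in _ - X]mulrC.
(* With zero diagonal [H] vanishes altogether, and [2 g x_uv] is already the square of
   [G p u - G p v]. *)
have [Hd|/existsNP[k h0]] := pselect (forall k, H k k = 0).
  have H0 u v : H u v = 0.
    apply: contrapT => Huv; apply: (fps_mul_neq0 Huv Huv).
    by rewrite {2}HC H22 Hd mul0r.
  exists (2 * g), (G p), (G p); split; first exact/fps_mul_neq0/g0/two_fps_neq0.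
  by move=> u v; rewrite Gg !H0; ring.
have Geven u v : fps_even (G u v).
  have xe u' v' : fps_even (pval 0 x u' v').
    rewrite /pval; case: insub => // ; case: insub => // ki _; exact: coef_fps0.
  by apply: fps_evenD; [apply: fps_evenD | apply: fps_evenN].
have Heven u v : fps_even (H u v).
  by apply: fps_evenD; [|apply: fps_evenN]; apply: fps_evenM; apply: Geven.
(* With [e^2 = - H k k] and [H k u * H k v = H k k * H u v], the product of the two factors is a
   difference of squares in which the [H] terms cancel. *)
have [m mP] := hasord_ex h0.
have [e eE] := fps_sqrt two_neq0 (hasordN mP) (hasord_even (Heven k k) mP).
exists (2 * (H k k * g)), (fun u => H k u - e * G p u), (fun u => H k u + e * G p u).
split; first by apply: fps_mul_neq0 (fps_mul_neq0 h0 g0); exact: two_fps_neq0.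
move=> u v.
have -> : (H k u - e * G p u - (H k v - e * G p v)) *
    (H k u + e * G p u - (H k v + e * G p v)) =
  H k u * H k u + H k v * H k v - 2 * (H k u * H k v)
  - (e * e) * ((G p u - G p v) * (G p u - G p v)) by ring.
have HH u' v' : H k u' * H k v' = H k k * H u' v' by rewrite (HC k u') H22 HC mulrC.
by rewrite eE Gg !HH; ring.
Qed.

End Splitting.

(** * From points of the variety to pairs of ultrametrics *)

Section TropicalPoints.
Variables (R : realType) (n : nat).

Lemma U_of_orders (F : fieldType) (a : 'I_n -> fps F) (D : 'I_n -> 'I_n -> nat) (N : nat) (c : R) :
  (0 < N)%N -> (forall u v, u != v -> hasord (a u - a v) (D u v)) ->
  U_ (fun s : pairs n => c - (D (val s).1 (val s).2)%:R / N%:R).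
Proof.
move=> N0 aD.
have DC u v : D u v = D v u.
  have [->//|uv] := eqVneq u v; apply: hasord_inj (aD u v uv) _.
  by rewrite -opprB; apply/hasordN/aD; rewrite eq_sym.
have pE u v : u != v ->
    pval 0 (fun s : pairs n => c - (D (val s).1 (val s).2)%:R / N%:R) u v = c - (D u v)%:R / N%:R.
  by move=> uv; apply: (@pvalE n R 0 (fun u v => c - (D u v)%:R / N%:R)) => // u1 v1; rewrite DC.
move=> u v w uv vw uw; rewrite !pE //.
have := hasord_sub (aD u v uv) (aD u w uw) (aD v w vw).
rewrite geq_min le_max !lerD2l !lerN2 !ler_pM2r ?invr_gt0 ?ltr0n //.
by rewrite !ler_nat.
Qed.

Lemma PG_K_laurent (x : pairs n -> series R) : (forall s, puiseux (x s)) ->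
  exists N M (A : pairs n -> fps (Cx R)), [/\ (0 < N)%N,
    x = (fun s => laurent N M (A s)) & forall s, fps_even (A s)].
Proof.
move=> xp; have /choice[f fP] := fun s => puiseux_laurent (xp s).
have /choice[m mP] := fP.
(* [N] is a multiple of twice each denominator and [M] is even and exceeds each pole bound, so all
   coordinates become even series with the same [N] and [M]. *)
pose N := (2 * \prod_s f s)%N; pose M := (2 * ((\sum_s m s) * N))%N.
have N0 : (0 < N)%N by rewrite muln_gt0 prodn_gt0 // => s; have [] := mP s.
have fN s : (2 * f s %| N)%N by rewrite dvdn_mul // (bigD1 s) //= dvdn_mulr.
have /choice[A AP] : forall s, exists A, x s = laurent N M A /\ fps_even A.
  move=> s; have [_ /(_ N M N0)[||A xA Ae]] := mP s.
  - by apply: dvdn_trans (fN s); rewrite dvdn_mull.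
  - rewrite /M mul2n -addnn; apply: leq_trans (leq_addr _ _).
    by rewrite leq_mul2r (bigD1 s) //= leq_addr orbT.
  exists A; split => //; apply: Ae; first exact: fN.
  by rewrite /M mul2n odd_double.
exists N, M, A; split => // [|s]; last by case: (AP s).
by apply/funext => s; case: (AP s).
Qed.

Lemma val_PG_K (x : pairs n -> series R) w : (2 <= n)%N -> PG_K x -> valvec x w ->
  minkowski (@U_ R n) (@U_ R n) w.
Proof.
move=> n2 [/PG_K_laurent[N [M [A [N0 -> Aeven]]]] xI] xw.
have /choice[K KP] : forall s, exists k, hasord (A s) k /\ w s = - ratr (expo N M k).
  move=> s; have [q [q0 [qmin ->]]] := xw s.
  by have [k Ak ->] := laurent_ord N0 q0 qmin; exists k.
pose o : 'I_n := Ordinal (ltnW n2); pose p : 'I_n := Ordinal n2.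
have two0 : 2 != 0 :> Cx R by rewrite pnatr_eq0.
have [||//|i k j l|z [a [b [z0 abE]]]] := @split_distances _ _ two0 A o p.
- by [].
- by move=> s; apply: hasord_neq0 (proj1 (KP s)).
- have := xI _ (@minor3_in_ideal R n o p i k p j l).
  rewrite (evalK_homog _ _ N0 (homog_minor3 _ _ _ _ _ _ _ _)) => /(laurent_inj N0).
  pose c : {rmorphism Cx R -> fps (Cx R)} := @fps_poly (Cx R) \o polyC.
  by rewrite -[meval _ _ _]/(meval c _ _) meval_minor3.
have [m zm] := hasord_ex z0.
(* Distinct points have non-zero differences, as their product is [z] times a non-zero coordinate;
   on the diagonal the orders are arbitrary. *)
have ords u v : exists de : nat * nat, u != v ->
    hasord (a u - a v) de.1 /\ hasord (b u - b v) de.2.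
  have [->|uv] := eqVneq u v; first by exists (0, 0)%N.
  have : hasord ((a u - a v) * (b u - b v)) (m + pval 0%N K u v).
    rewrite abE; apply: hasordM zm _; rewrite /pval; case: insubP => [s _ _|].
      exact: (proj1 (KP s)).
    case: insubP => [s _ _ _|/=]; first exact: (proj1 (KP s)).
    by rewrite -!leqNgt => h1 h2; case/negP: uv; rewrite -val_eqE eqn_leq h1 h2.
  by move=> /hasordM_inv[k [l [ak bl _]]]; exists (k, l).
have /choice[D DP] : forall u, exists D : 'I_n -> nat * nat, forall v, u != v ->
    hasord (a u - a v) (D v).1 /\ hasord (b u - b v) (D v).2.
  by move=> u; have [E EP] := choice (ords u); exists E.
(* The pole bound [M] and the order [m] of [z] shift all coordinates equally; both go into the
   second summand, since adding a constant preserves ultrametrics. *)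
exists (fun s => 0 - (D (val s).1 (val s).2).1%:R / N%:R).
exists (fun s => (M + m)%:R / N%:R - (D (val s).1 (val s).2).2%:R / N%:R).
split; first by apply: (U_of_orders (a := a) (D := fun u v => (D u v).1)) => // u v /DP[].
split; first by apply: (U_of_orders (a := b) (D := fun u v => (D u v).2)) => // u v /DP[].
apply/funext => s; have [As ->] := KP s.
have uv : (val s).1 != (val s).2 by rewrite -val_eqE neq_ltn (valP s).
have [ak bl] := DP _ _ uv.
have := hasordM ak bl; rewrite abE pval_val => /hasord_inj/(_ (hasordM zm As)) kl.
rewrite ratr_expo sub0r -!mulNr -!mulrDl.
congr (_ / _); have := congr1 (fun k => k%:R : R) kl; rewrite !natrD; lra.
Qed.

End TropicalPoints.

Theorem theorem3p1 (R : realType) (n : nat) (hn : (2 <= n)%N) :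
  @trop_PG R n = minkowski (@U_ R n) (@U_ R n).
Proof.
apply/seteqP; split; last exact: minkowski_sub_trop.
move=> w wtrop; apply: minkowski_U_closed => e /wtrop[v [[x [xK xv]] wv]].
by exists v; split => //; exact: val_PG_K hn xK xv.
Qed.
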